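(* For every $(t,x)\in\mathbf{N}\times\partial B$ and every $f\in\mathcal{M}_B^d$, $$\mathcal{N}f(x-te_d)=\sum_{(s,y)\in\mathcal{S}(t,x)}c_{t,x}(s,y)\,f(y+se_d),$$ where, for $(s,y)\in\mathbf{N}\times\partial B$, $$c_{t,x}(s,y)=\frac{1}{\prod_{(l,w)\in\mathcal{S}(t,x)}P(Z_l^w=w-le_d)}\sum_{\sigma\in\mathrm{Sym}(\mathcal{S}(t,x))}\mathrm{sgn}(\sigma)\,P\bigl(Z_{\sigma_1(t,x)}^{\sigma_2(t,x)}=y+se_d\bigr)\prod_{(h,z)\in\mathcal{S}(t,x)\setminus\{(t,x)\}}P\bigl(Z_{\sigma_1(h,z)}^{\sigma_2(h,z)}=z-he_d\bigr).$$ Here $\mathcal{N}$ is the discrete Carr-Nadtochiy transform defined in the context.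
   Context: Let $\mathbf{N}=\{1,2,\dots\}$, $d\in\mathbf{N}$, $e_1,\dots,e_d$ the standard unit vectors of $\mathbf{Z}^d$, $B=\{x\in\mathbf{Z}^d: x_d>0\}$, $\partial B=\{x\in\mathbf{Z}^d: x_d=0\}$, so $B^c\setminus\partial B=\{x\in\mathbf{Z}^d: x_d<0\}$. For $x\in\mathbf{Z}^d$, $(Z_t^x)_{t\in\mathbf{Z}_+}$ denotes a discrete-time, time-homogeneous Markov chain on $\mathbf{Z}^d$ started at $x$ (all with the same transition kernel), with $\sum_{i=1}^d P(Z_1^x=x+e_i)+\sum_{i=1}^d P(Z_1^x=x-e_i)=1$ and $P(Z_1^x=x+e_i)>0$, $P(Z_1^x=x-e_i)>0$ for all $i=1,\dots,d$ and all $x\in\mathbf{Z}^d$. For $A\subset\mathbf{Z}^d$, $\mathcal{M}_A^d$ is the set of functions $\mathbf{Z}^d\to\mathbf{R}$ vanishing outside $A$. For $(t,x)\in\mathbf{N}\times\partial B$, with $\|\cdot\|$ the $\ell^1$-norm, let $$\mathcal{S}(t,x)=\{(s,y)\in\mathbf{N}\times\partial B:\ 1\le s\le t,\ \|y-x\|\le t-s,\ t-s-\|y-x\|\text{ is even}\},$$ a finite set containing $(t,x)$. Let $W^{+}_{t,x}$ and $W^{-}_{t,x}$ be the square matrices indexed by $\mathcal{S}(t,x)\times\mathcal{S}(t,x)$ with entry in row $(s,y)$, column $(u,z)$ equal to $P(Z_s^y=z+u e_d)$ and $P(Z_s^y=z-u e_d)$, respectively. These matrices are invertible. Put $\mathcal{N}_{t,x}=(W^-_{t,x})^{-1}W^+_{t,x}$.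 For $h\in\mathcal{M}_B^d$, apply $\mathcal{N}_{t,x}$ to the vector $(h(z+ue_d))_{(u,z)\in\mathcal{S}(t,x)}$ and denote the $(s,y)$-component of the result by $\mathcal{N}_{t,x}h(y-se_d)$, for $(s,y)\in\mathcal{S}(t,x)$. The map $\mathcal{N}:\mathcal{M}_B^d\to\mathcal{M}_{B^c\setminus\partial B}^d$ is defined by $\mathcal{N}h(x-te_d)=\mathcal{N}_{t,x}h(x-te_d)$ for $(t,x)\in\mathbf{N}\times\partial B$ (and $\mathcal{N}h=0$ on $B\cup\partial B$). $\mathrm{Sym}(\mathcal{S}(t,x))$ is the group of permutations of the finite set $\mathcal{S}(t,x)$, $\mathrm{sgn}$ is the sign, and for a permutation $\sigma$ we write $\sigma(s,y)=(\sigma_1(s,y),\sigma_2(s,y))\in\mathbf{N}\times\partial B$. The denominator $\prod_{(l,w)\in\mathcal{S}(t,x)}P(Z_l^w=w-le_d)$ is nonzero. *)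

(* Defs.v *)
From HB Require Import structures.
From mathcomp Require Export all_boot all_order all_algebra all_fingroup finmap.
From mathcomp Require Export all_classical all_reals all_analysis.

Set Implicit Arguments.
Unset Strict Implicit.
Unset Printing Implicit Defensive.

Import Order.TTheory GRing.Theory Num.Theory.

Local Open Scope classical_set_scope.
Local Open Scope ring_scope.

(* The dimension d >= 1 is written n.+1, so that the last coordinate is
   ord_max : 'I_n.+1 and Z^d is 'rV[int]_n.+1. *)

Definition unitv (n : nat) (i : 'I_n.+1) : 'rV[int]_n.+1 := delta_mx 0 i.

(* up y s = y + s e_d and down y s = y - s e_d *)
Definition up (n : nat) (y : 'rV[int]_n.+1) (s : nat) : 'rV[int]_n.+1 :=
  y + unitv ord_max *+ s.
Definition down (n : nat) (y : 'rV[int]_n.+1) (s : nat) : 'rV[int]_n.+1 :=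
  y - unitv ord_max *+ s.

Definition halfspace (n : nat) : set 'rV[int]_n.+1 :=
  [set x | 0 < x 0 ord_max].
Definition boundary (n : nat) : set 'rV[int]_n.+1 :=
  [set x | x 0 ord_max = 0].
Definition lower (n : nat) : set 'rV[int]_n.+1 :=
  ~` @halfspace n `\` @boundary n.

Definition vanishing_outside (R : realType) (n : nat) (A : set 'rV[int]_n.+1) :
  set ('rV[int]_n.+1 -> R) := [set f | forall x, ~ A x -> f x = 0].

Definition norm1 (n : nat) (x : 'rV[int]_n.+1) : nat :=
  (\sum_(i < n.+1) absz (x 0%R i))%N.

Section Chain.
Context (R : realType) (disp : measure_display) (T : measurableType disp).
Context (P : probability T R).

Definition prob (A : set T) : R := fine (P A).

(* Discrete-time Markov chain on a countable state space E, started at x, with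
   transition probabilities k; w lists the states of a possible history. *)
Record markov_chain (E : countType) (k : E -> E -> R) (x : E)
    (Z : nat -> T -> E) : Prop := MarkovChain {
  chain_measurable : forall t y, measurable [set om | Z t om = y];
  chain_start : prob [set om | Z 0%N om = x] = 1;
  chain_step : forall (t : nat) (w : nat -> E) (y : E),
    let H := [set om | forall i, (i <= t)%N -> Z i om = w i] in
    0 < prob H ->
    prob ([set om | Z t.+1 om = y] `&` H) / prob H = k (w t) y
}.

Definition markov_family (E : countType) (Z : E -> nat -> T -> E) : Prop :=
  exists k : E -> E -> R,
    [/\ forall x y, 0 <= k x y,
        forall x, (\esum_(y in [set: E]) (k x y)%:E)%E = 1%E
      & forall x, markov_chain k x (Z x)].

Context (n : nat).
Implicit Types Z : 'rV[int]_n.+1 -> nat -> T -> 'rV[int]_n.+1.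

Definition trans Z (t : nat) (x y : 'rV[int]_n.+1) : R :=
  prob [set om | Z x t om = y].

Definition nearest_neighbour Z : Prop :=
  forall x : 'rV[int]_n.+1,
    \sum_(i < n.+1) trans Z 1 x (x + unitv i)
    + \sum_(i < n.+1) trans Z 1 x (x - unitv i) = 1
    /\ forall i : 'I_n.+1,
         0 < trans Z 1 x (x + unitv i) /\ 0 < trans Z 1 x (x - unitv i).

End Chain.

Section IndexSet.
Context (n : nat).

Definition index_set (t : nat) (x : 'rV[int]_n.+1) :
    set (nat * 'rV[int]_n.+1) :=
  [set p | [/\ boundary p.2, (1 <= p.1 <= t)%N,
               (norm1 (p.2 - x)%R <= t - p.1)%N
             & ~~ odd (t - p.1 - norm1 (p.2 - x)%R)]].

Lemma index_set_finite (t : nat) (x : 'rV[int]_n.+1) :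
  finite_set (index_set t x).
Proof.
pose F (g : 'I_t.+1 * {ffun 'I_n.+1 -> 'I_(t + t).+1}) :=
  (nat_of_ord g.1, x + \row_i ((g.2 i)%:Z - t%:Z)).
apply: (@sub_finite_set _ _ (F @` [set: _])); last first.
  by apply: finite_image; apply: finite_finset.
move=> [s y] [/= _ /andP[_ st] yx _].
have bd i : (absz ((y - x)%R 0%R i) <= t)%N.
  apply: leq_trans (leq_trans yx (leq_subr _ _)).
  by rewrite /norm1 (bigD1 i)//= leq_addr.
have bd0 i : 0 <= (y - x) 0 i + t%:Z <= (t + t)%:Z.
  have := bd i; rewrite -lez_nat abszE ler_norml => /andP[lo hi].
  by rewrite -lerBlDr sub0r lo PoszD lerD2r.
exists (inord s, [ffun i => inord (absz ((y - x) 0 i + t%:Z))]) => //.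
rewrite /F /= inordK ?ltnS//; congr pair.
apply/rowP => i; have /andP[lo hi] := bd0 i.
rewrite mxE mxE ffunE inordK; last by rewrite ltnS -lez_nat gez0_abs.
by rewrite gez0_abs// addrK !mxE addrC subrK.
Qed.

(* fset_set is the empty set on infinite sets, hence index_set_finite. *)
Definition calS (t : nat) (x : 'rV[int]_n.+1) : {fset nat * 'rV[int]_n.+1} :=
  fset_set (index_set t x).

Lemma in_calS (t : nat) (x : 'rV[int]_n.+1) (p : nat * 'rV[int]_n.+1) :
  p \in calS t x <-> index_set t x p.
Proof. by rewrite in_fset_set ?inE//; exact: index_set_finite. Qed.

Lemma apex_in_calS (t : nat) (x : 'rV[int]_n.+1) :
  (0 < t)%N -> boundary x -> (t, x) \in calS t x.
Proof.
move=> t0 bx; apply/in_calS; split => //=; first by rewrite t0 leqnn.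
  by rewrite subrr /norm1 big1// => i _; rewrite mxE.
by rewrite subnn sub0n.
Qed.

(* (t,x) as an element of calS t x *)
Definition apex (t : nat) (x : 'rV[int]_n.+1) (t0 : (0 < t)%N)
    (bx : boundary x) : calS t x := [` apex_in_calS t0 bx]%fset.

End IndexSet.

Section CarrNadtochiy.
Context (R : realType) (disp : measure_display) (T : measurableType disp).
Context (P : probability T R) (n : nat).
Context (Z : 'rV[int]_n.+1 -> nat -> T -> 'rV[int]_n.+1).

(* Rows and columns of the matrices below are numbered through the enumeration
   of the finite type calS t x. *)
Definition Wplus (t : nat) (x : 'rV[int]_n.+1) : 'M[R]_#|{: calS t x}| :=
  \matrix_(i, j) let sy := val (enum_val i) in let uz := val (enum_val j) in
    trans P Z sy.1 sy.2 (up uz.2 uz.1).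

Definition Wminus (t : nat) (x : 'rV[int]_n.+1) : 'M[R]_#|{: calS t x}| :=
  \matrix_(i, j) let sy := val (enum_val i) in let uz := val (enum_val j) in
    trans P Z sy.1 sy.2 (down uz.2 uz.1).

Definition Nmx (t : nat) (x : 'rV[int]_n.+1) : 'M[R]_#|{: calS t x}| :=
  invmx (Wminus t x) *m Wplus t x.

(* N_{t,x} h (y - s e_d), as a function of the index (s,y) in calS t x *)
Definition Nloc (t : nat) (x : 'rV[int]_n.+1) (h : 'rV[int]_n.+1 -> R)
    (sy : calS t x) : R :=
  (Nmx t x *m \col_j let uz := val (enum_val j) in h (up uz.2 uz.1))
    (enum_rank sy) 0.

(* A point v with v_d < 0 is written v = x - t e_d with t = |v_d| and
   x = v + t e_d in the boundary; then (t,x) is in calS t x, so that the partial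
   projection insub succeeds. *)
Definition carr_nadtochiy (h : 'rV[int]_n.+1 -> R) (v : 'rV[int]_n.+1) : R :=
  let t := absz (v 0 ord_max) in
  let x := up v t in
  if v 0 ord_max < 0 then oapp (Nloc h) 0 (insub (t, x) : option (calS t x))
  else 0.

Lemma carr_nadtochiy_lower (h : 'rV[int]_n.+1 -> R) :
  vanishing_outside (@lower n) (carr_nadtochiy h).
Proof.
move=> v; rewrite /carr_nadtochiy; case: ifP => // v0 nv; case: nv; split => /=.
  by rewrite /setC /halfspace /= => /(lt_trans v0); rewrite ltxx.
by rewrite /boundary /= => ve; rewrite ve ltxx in v0.
Qed.

Lemma carr_nadtochiyE (h : 'rV[int]_n.+1 -> R) (t : nat) (x : 'rV[int]_n.+1)
    (t0 : (0 < t)%N) (bx : boundary x) :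
  carr_nadtochiy h (down x t) = Nloc h (apex t0 bx).
Proof.
have e : down x t 0 ord_max = - t%:Z.
  rewrite /down 2!mxE bx sub0r; congr -%R; rewrite mulmxnE mxE !eqxx; exact: natz.
rewrite /carr_nadtochiy e abszN absz_nat oppr_lt0 ltz_nat t0.
have -> : up (down x t) t = x by rewrite /up /down subrK.
by rewrite (insubT (fun p => p \in calS t x) (apex_in_calS t0 bx)).
Qed.

Definition coef (t : nat) (x : 'rV[int]_n.+1) (t0 : (0 < t)%N)
    (bx : boundary x) (s : nat) (y : 'rV[int]_n.+1) : R :=
  let o := apex t0 bx in
  (\prod_(p : calS t x)
     trans P Z (val p).1 (val p).2 (down (val p).2 (val p).1))^-1
  * \sum_(sigma : {perm calS t x})
      (-1) ^+ sigma
      * trans P Z (val (sigma o)).1 (val (sigma o)).2 (up y s)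
      * \prod_(p : calS t x | p != o)
          trans P Z (val (sigma p)).1 (val (sigma p)).2
                (down (val p).2 (val p).1).

End CarrNadtochiy.

(* Main.v *)
Require Import Defs.

(** The value of the transform at [down x t] is the apex component of
    [invmx Wminus *m Wplus] applied to the values of [f], so the coefficient of
    [f (up y s)] is the entry of [invmx Wminus *m Wplus] in the row of [(t, x)]
    and the column of [(s, y)].  By Cramer's rule (cramer_mulmx) this entry is
    a quotient of determinants: the denominator is the determinant of [Wminus],
    and in the numerator the column of [(t, x)] is replaced by the column of
    [Wplus] at [(s, y)].  The Leibniz expansion of the numerator over the
    permutations of the index set (det_enum) is the sum in [coef].

    It remains to see that the determinant of [Wminus] is the product of its
    diagonal entries and that this product is not zero.  A walk making unit steps
    is within distance [s] of its start at time [s] (trans_gt0_norm1).  An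
    entry of [Wminus] in row [(s, y)] and column [(u, z)] can therefore be
    nonzero only if [u < s] or the two indices agree (boundary_down_time), so
    [Wminus] is triangular for the weight given by time (det_weight_triangular).
    A diagonal entry is the probability of being [s] levels below the start at
    time [s], which is positive because each downward step has positive
    probability (trans_down_gt0).

    Both facts on the walk follow from a description of its histories: a
    finite history has positive probability exactly when all its steps have
    positive transition probability (prob_cylinder_gt0), and a state of positive
    probability ends such a history (reachable_history). *)

Set Implicit Arguments.
Unset Strict Implicit.
Unset Printing Implicit Defensive.

Import Order.TTheory GRing.Theory Num.Theory.

Local Open Scope ring_scope.

(** * Determinants over an arbitrary finite index type *)

Section EnumDet.
Variable I : finType.

(** Conjugation by the enumeration of [I], which turns the permutations of [I]
    in the coefficient formula into the permutations of ordinals over which a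
    matrix determinant is expanded. *)
Definition ord_perm (s : {perm I}) : {perm 'I_#|I|} :=
  perm (inj_comp enum_rank_inj (inj_comp (@perm_inj _ s) enum_val_inj)).

Definition unord_perm (s : {perm 'I_#|I|}) : {perm I} :=
  perm (inj_comp enum_val_inj (inj_comp (@perm_inj _ s) enum_rank_inj)).

Lemma ord_permE s i : ord_perm s i = enum_rank (s (enum_val i)).
Proof. by rewrite permE. Qed.

Lemma ord_perm_bij : bijective ord_perm.
Proof.
by exists unord_perm => s; apply/permP => i;
   rewrite !permE /= !permE /= ?enum_rankK ?enum_valK ?enum_rankK ?enum_valK.
Qed.

(** Conjugation is multiplicative and maps a transposition to a transposition,
    and every permutation is a product of transpositions. *)
Lemma odd_ord_perm s : ord_perm s = s :> bool.
Proof.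
have ordM u v : ord_perm (u * v)%g = (ord_perm u * ord_perm v)%g.
  by apply/permP => i; rewrite permM !ord_permE permM enum_rankK.
have ordT a b : ord_perm (tperm a b) = tperm (enum_rank a) (enum_rank b).
  apply/permP => i; rewrite ord_permE -[i in RHS]enum_valK.
  by rewrite (inj_tperm _ _ _ enum_rank_inj).
have [ts -> _] := prod_tpermP s; elim: ts => [|[a b] ts IH].
  rewrite big_nil (_ : ord_perm 1 = 1)%g ?odd_perm1 //.
  by apply/permP => i; rewrite ord_permE !perm1 enum_valK.
rewrite big_cons ordM ordT !odd_permM IH !odd_tperm.
by rewrite (inj_eq enum_rank_inj).
Qed.

(** The permutation acts on the row index, as it does in the coefficients of the
    transform; hence the transposition at the start of the proof. *)
Lemma det_enum (R : comNzRingType) (A : I -> I -> R) :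
  \det (\matrix_(i, j) A (enum_val i) (enum_val j) : 'M[R]_#|I|) =
  \sum_(s : {perm I}) (-1) ^+ s * \prod_p A (s p) p.
Proof.
rewrite -det_tr /determinant (reindex ord_perm) /=; last first.
  exact/onW_bij/ord_perm_bij.
apply: eq_bigr => s _; rewrite odd_ord_perm; congr (_ * _).
rewrite (reindex (@enum_rank I)) /=; last exact/onW_bij/enum_rank_bij.
by apply: eq_bigr => p _; rewrite !mxE ord_permE !enum_rankK.
Qed.

End EnumDet.

(** A permutation contributing to the expansion never increases the weight, and
    decreases it at each index that it moves.  It also preserves the total
    weight, so it moves nothing. *)
Lemma det_weight_triangular (R : comNzRingType) m (mu : 'I_m -> nat)
    (A : 'M[R]_m) :
  (forall i j, i != j -> A i j != 0 -> (mu j < mu i)%N) ->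
  \det A = \prod_i A i i.
Proof.
move=> triA; rewrite /determinant (bigD1 1%g) //= odd_perm1 expr0 mul1r.
rewrite [X in _ + X]big1 ?addr0 => [|s s1].
  by apply: eq_bigr => i _; rewrite perm1.
have [/forallP nz|/forallPn[i]] := boolP [forall i, A i (s i) != 0]; last first.
  by rewrite negbK => /eqP Ai0; rewrite (bigD1 i) //= Ai0 mul0r mulr0.
have [i si] : exists i, s i != i.
  apply/existsP; apply: contraNT s1; rewrite negb_exists => /forallP fixs.
  apply/eqP/permP => i; rewrite perm1; apply/eqP.
  by move: (fixs i); rewrite negbK.
have le_mu j : (mu (s j) <= mu j)%N.
  have [->//|sj] := eqVneq (s j) j.
  by apply: ltnW; apply: triA (nz j); rewrite eq_sym.
have : (\sum_j mu (s j) < \sum_j mu j)%N.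
  rewrite (bigD1 i) // [X in (_ < X)%N](bigD1 i) //= -addSn leq_add ?leq_sum //.
  by apply: triA (nz i); rewrite eq_sym.
by rewrite [X in (_ < X)%N](reindex_inj (@perm_inj _ s)) ltnn.
Qed.

(** Cramer's rule: expanding the modified determinant along its column [i]
    gives row [i] of the adjugate of [A] times column [j] of [B], because the
    cofactors of column [i] do not see the replaced column. *)
Lemma cramer_mulmx (R : comUnitRingType) m p (A : 'M[R]_m) (B : 'M[R]_(m, p))
    (i : 'I_m) (j : 'I_p) : A \in unitmx ->
  (invmx A *m B) i j =
  (\det A)^-1 * \det (\matrix_(k, l) if l == i then B k j else A k l).
Proof.
move=> uA; rewrite /invmx uA -scalemxAl mxE; congr (_ * _).
rewrite (expand_det_col _ i) mxE; apply: eq_bigr => k _.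
rewrite !mxE eqxx mulrC; congr (_ * _); rewrite /cofactor; congr (_ * \det _).
by apply/matrixP => a b; rewrite !mxE eq_sym (negPf (neq_lift _ _)).
Qed.

(** * Paths of a countable Markov chain *)

Section Chain.
Context (R : realType) (disp : measure_display) (T : measurableType disp).
Context (P : probability T R).
Local Open Scope classical_set_scope.

Lemma prob_ge0 A : 0 <= prob P A.
Proof. exact: fine_ge0. Qed.

Lemma prob_eq0 A : measurable A -> prob P A = 0 -> P A = 0%E.
Proof.
by move=> mA pA; rewrite -[P A]fineK ?fin_num_measure// -/(prob P A) pA.
Qed.

Lemma prob_le A B : measurable A -> measurable B -> A `<=` B ->
  prob P A <= prob P B.
Proof.
move=> mA mB AB; rewrite fine_le ?fin_num_measure//.
by apply: le_measure; rewrite ?inE.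
Qed.

Section CountableStates.
Context (E : countType) (k : E -> E -> R) (x : E) (Z : nat -> T -> E).
Hypothesis chainZ : markov_chain P k x Z.

Definition cylinder (w : nat -> E) (t : nat) : set T :=
  [set om | forall i, (i <= t)%N -> Z i om = w i].

Lemma cylinderS w t :
  cylinder w t.+1 = [set om | Z t.+1 om = w t.+1] `&` cylinder w t.
Proof.
apply/seteqP; split=> om => [h|[h1 h2] i].
  by split=> [|i it]; apply: h => //; exact: leqW.
by rewrite leq_eqVlt => /orP[/eqP->//|/h2].
Qed.

Lemma cylinder0 w : cylinder w 0 = [set om | Z 0%N om = w 0%N].
Proof.
by apply/seteqP; split=> om => [h|h i]; [exact: h | rewrite leqn0 => /eqP->].
Qed.

Lemma measurable_cylinder w t : measurable (cylinder w t).
Proof.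
elim: t => [|t IH]; first by rewrite cylinder0; exact: (chain_measurable chainZ).
by rewrite cylinderS; apply: measurableI => //; exact: (chain_measurable chainZ).
Qed.

Lemma prob_start_setI A : measurable A ->
  prob P (A `&` [set om | Z 0%N om = x]) = prob P A.
Proof.
move=> mA; have mx := chain_measurable chainZ 0 x.
have Px : P [set om | Z 0%N om = x] = 1%E.
  by rewrite -[LHS]fineK ?fin_num_measure// -/(prob P _) (chain_start chainZ).
have Pn : P (~` [set om | Z 0%N om = x]) = 0%E.
  by rewrite probability_setC // Px subee.
rewrite /prob; congr fine.
rewrite -[in RHS](setIT A) -(setUv [set om | Z 0%N om = x]) setIUr measureU0 //.
- exact: measurableI.
- by apply: measurableI => //; exact: measurableC.
apply: (subset_measure0 _ _ _ Pn); last exact: subIsetr.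
- by apply: measurableI => //; exact: measurableC.
- exact: measurableC.
Qed.

Lemma prob_one_step y : prob P [set om | Z 1%N om = y] = k x y.
Proof.
have := chain_step chainZ (t := 0) (w := fun=> x) y.
rewrite /= -/(cylinder (fun=> x) 0) cylinder0 (chain_start chainZ) divr1.
by rewrite prob_start_setI => [->//|]; exact: (chain_measurable chainZ).
Qed.

(** The probability of a history is the product of its transition probabilities,
    but only its sign matters here.  One can condition on the history up to time
    [t] only if it has positive probability, whence the case distinction; an
    extension of a null history is null. *)
Lemma prob_cylinder_gt0 w t :
  0 < prob P (cylinder w t) <->
  w 0%N = x /\ forall i, (i < t)%N -> 0 < k (w i) (w i.+1).
Proof.
elim: t => [|t IH].
  rewrite cylinder0; split=> [p0|[-> _]]; last by rewrite (chain_start chainZ).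
  split=> //; apply: contrapT => wx; move: p0.
  rewrite -prob_start_setI; last exact: (chain_measurable chainZ).
  rewrite (_ : _ `&` _ = set0) /prob ?measure0 ?ltxx//.
  by apply/seteqP; split=> // om [/= -> /wx].
have [p0|] := boolP (0 < prob P (cylinder w t)); last first.
  rewrite -leNgt => p0; split=> [p1|[w0 kw]].
    move: p0; rewrite leNgt => /negP[]; apply: lt_le_trans p1 _.
    apply: prob_le; try exact: measurable_cylinder.
    by rewrite cylinderS; exact: subIsetr.
  suff: 0 < prob P (cylinder w t) by move=> /lt_le_trans/(_ p0); rewrite ltxx.
  by apply/IH; split=> // i it; apply: kw; exact: ltnW.
have step := chain_step chainZ (w t.+1) p0.
have -> : prob P (cylinder w t.+1) = k (w t) (w t.+1) * prob P (cylinder w t).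
  by rewrite cylinderS -step divfK // gt_eqF.
rewrite pmulr_lgt0 //; have [w0 kw] := IH.1 p0.
split=> [kt|[_ h]]; last exact: h.
split=> // i; rewrite ltnS leq_eqVlt => /orP[/eqP->//|]; exact: kw.
Qed.

(** There are countably many histories up to time [t], so an event of positive
    probability that depends on them contains one of positive probability. *)
Lemma reachable_history t v : 0 < prob P [set om | Z t om = v] ->
  exists w, [/\ w 0%N = x, w t = v & forall i, (i < t)%N -> 0 < k (w i) (w i.+1)].
Proof.
move=> pv; apply: contrapT => noh.
have mv := chain_measurable chainZ t v.
(* every history up to time [t] agrees with some [w j], padded with [x] after
   time [t], where its values do not matter *)
pose w (j i : nat) : E :=
  nth x (odflt [::] (choice.unpickle j : option (seq E))) i.
pose F j := cylinder (w j) t `&` [set om | Z t om = v].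
have mF j : measurable (F j).
  by apply: measurableI => //; exact: measurable_cylinder.
suff : P.-negligible [set om | Z t om = v].
  by move=> /(negligibleP P mv) p0; move: pv; rewrite /prob p0 ltxx.
apply: (@negligibleS _ _ _ P (\bigcup_j F j)).
  move=> om /= Zv; exists (choice.pickle (mkseq (Z^~ om) t.+1)) => //.
  split=> // i it; rewrite /w choice.pickleK /odflt /oapp nth_mkseq //.
apply: negligible_bigcup => j; apply/(negligibleP P (mF j)).
have [wv|wv] := eqVneq (w j t) v; last first.
  rewrite (_ : F j = set0) ?measure0//; apply/seteqP; split=> // om [/= h Zv].
  by case/eqP: wv; rewrite -Zv (h t).
apply/prob_eq0 => //; apply/eqP; rewrite eq_le prob_ge0 andbT leNgt.
apply/negP => Fj; apply: noh; exists (w j).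
have /prob_cylinder_gt0[w0 kw] : 0 < prob P (cylinder (w j) t).
  apply: lt_le_trans Fj _; apply: prob_le => //; first exact: measurable_cylinder.
  exact: subIsetl.
by split.
Qed.

End CountableStates.

(** The values of the kernel at the points [g j] exhaust its total mass. *)
Lemma kernel_support (E : countType) (k : E -> E -> R) (x : E) (J : finType)
    (g : J -> E) :
  (\esum_(y in [set: E]) (k x y)%:E)%E = 1%E ->
  injective g -> \sum_j k x (g j) = 1 ->
  forall y, 0 < k x y -> exists j, y = g j.
Proof.
move=> k1 gi gs y ky; apply: contrapT => ny.
have : ((k x y + 1)%:E <= 1)%E.
  rewrite -k1; apply: esum_ge.
  exists [set` y :: [seq g j | j <- enum J]].
    by split=> //; exact: finite_seq.
  rewrite -fsbig_seq /=; last first.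
    rewrite map_inj_uniq // enum_uniq andbT; apply/mapP => -[j _ yj].
    by apply: ny; exists j.
  by rewrite big_cons big_map big_enum /= sumEFin gs.
by rewrite lee_fin gerDr leNgt ky.
Qed.

End Chain.

(** * Geometry of the lattice *)

Section Lattice.
Context (n : nat).
Implicit Types x y z u v : 'rV[int]_n.+1.

Lemma norm1D u v : (norm1 (u + v) <= norm1 u + norm1 v)%N.
Proof.
rewrite /norm1 -big_split /=; apply: leq_sum => i _; rewrite mxE.
by rewrite -lez_nat PoszD !abszE ler_normD.
Qed.

Lemma norm1_unitv (i : 'I_n.+1) : norm1 (unitv i) = 1%N.
Proof.
rewrite /norm1 (bigD1 i) //= big1 => [|j /negPf ji]; first by rewrite mxE !eqxx.
by rewrite mxE ji.
Qed.

Lemma norm1N u : norm1 (- u) = norm1 u.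
Proof. by apply: eq_bigr => i _; rewrite mxE abszN. Qed.

Definition nbr x (e : bool * 'I_n.+1) :=
  x + (if e.1 then unitv e.2 else - unitv e.2).

Lemma nbr_inj x : injective (nbr x).
Proof.
move=> [b i] [c j] /addrI /matrixP /(_ 0 i).
by case: b c => -[] /=; rewrite !mxE ?eqxx /=; have [->|] := eqVneq i j.
Qed.

Lemma norm1_nbr x e : norm1 (nbr x e - x) = 1%N.
Proof.
by rewrite /nbr addrC addKr; case: e.1; rewrite ?norm1N norm1_unitv.
Qed.

Lemma norm1_path (w : nat -> 'rV[int]_n.+1) t :
  (forall i, (i < t)%N -> (norm1 (w i.+1 - w i) <= 1)%N) ->
  (norm1 (w t - w 0%N) <= t)%N.
Proof.
elim: t => [_|t IH stepw].
  by rewrite subrr /norm1 big1 // => i _; rewrite mxE.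
rewrite -(subrKA (w t)); apply: leq_trans (norm1D _ _) _.
apply: (@leq_add _ _ 1 t); first exact: stepw.
by apply: IH => i it; apply: stepw; exact: ltnW.
Qed.

Lemma downS y s : down y s.+1 = nbr (down y s) (false, ord_max).
Proof. by rewrite /down /nbr /= mulrSr opprD addrA. Qed.

(** For [y] and [z] in the boundary, the vertical and horizontal displacements
    add up: [norm1 (down z u - y)] is [u + norm1 (z - y)].  Hence [u <= s], and
    [u = s] leaves no room for a horizontal displacement.  This is why the
    matrix [Wminus] is triangular with respect to time. *)
Lemma boundary_down_time (s : nat) y (u : nat) z : boundary y -> boundary z ->
  (norm1 (down z u - y) <= s)%N -> (s, y) != (u, z) -> (u < s)%N.
Proof.
move=> y0 z0; rewrite /norm1 (bigD1 ord_max) //= !mxE y0 z0 subr0 sub0r.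
rewrite mulmxnE mxE !eqxx abszN -[_ *+ u]/(u%:R) natz absz_nat => le_s.
apply: contraNltn => le_u.
have us : u = s.
  by apply/eqP; rewrite eqn_leq le_u andbT (leq_trans _ le_s) ?leq_addr.
move: le_s; rewrite us -[X in (_ <= X)%N]addn0 leq_add2l leqn0 sum_nat_eq0.
move=> /forallP same; apply/eqP; congr pair; apply/rowP => i.
have [->|i_max] := eqVneq i ord_max; first by rewrite y0 z0.
have := same i; rewrite i_max /= !mxE mulmxnE mxE (negPf i_max) andbF mul0rn.
by rewrite subr0 absz_eq0 subr_eq0 => /eqP.
Qed.

End Lattice.

(** * The nearest-neighbour walk and its matrices *)

Section Walk.
Context (R : realType) (disp : measure_display) (T : measurableType disp).
Context (P : probability T R) (n : nat).
Context (Z : 'rV[int]_n.+1 -> nat -> T -> 'rV[int]_n.+1).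
Hypotheses (markovZ : markov_family P Z) (nnZ : nearest_neighbour P Z).

Lemma walk_kernel : exists k : 'rV[int]_n.+1 -> 'rV[int]_n.+1 -> R,
  [/\ forall x, markov_chain P k x (Z x),
      forall x y, 0 < k x y -> (norm1 (y - x) <= 1)%N
    & forall x e, 0 < k x (nbr x e)].
Proof.
have [k [k0 k1 chainZ]] := markovZ; exists k; split=> // [x y|x [b i]].
  have kE z : trans P Z 1 x z = k x z by exact: prob_one_step.
  move=> kxy; suff [e ->] : exists e, y = nbr x e by rewrite norm1_nbr.
  apply: kernel_support kxy => //; first exact: nbr_inj.
  rewrite -(pair_bigA _ (fun b i => k x (nbr x (b, i)))) /= big_bool /=.
  have [<- _] := nnZ x; congr (_ + _); by apply: eq_bigr => i _; rewrite kE.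
have [_ /(_ i)[]] := nnZ x; rewrite /trans.
by rewrite !(prob_one_step (chainZ x)) /nbr; case: b.
Qed.

Lemma trans_gt0_norm1 s y v :
  0 < trans P Z s y v -> (norm1 (v - y) <= s)%N.
Proof.
have [k [chainZ kn _]] := walk_kernel.
move=> /(reachable_history (chainZ y))[w [w0 <- kw]].
by rewrite -w0; apply: norm1_path => i it; apply/kn/kw.
Qed.

(** The walk may go straight down at every step. *)
Lemma trans_down_gt0 s y : 0 < trans P Z s y (down y s).
Proof.
have [k [chainZ _ kpos]] := walk_kernel.
have : 0 < prob P (cylinder (Z y) (down y) s).
  apply/(prob_cylinder_gt0 (chainZ y)); split=> [|i _].
    by rewrite /down mulr0n subr0.
  by rewrite downS.
move=> /lt_le_trans; apply; apply: prob_le => [||om]; last exact.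
  exact: (measurable_cylinder (chainZ y)).
exact: (chain_measurable (chainZ y)).
Qed.

Lemma det_Wminus t x : \det (Wminus P Z t x) =
  \prod_(p : calS t x) trans P Z (val p).1 (val p).2 (down (val p).2 (val p).1).
Proof.
rewrite (@det_weight_triangular _ _ (fun i => (val (enum_val i)).1)) => [|i j].
  rewrite (reindex (@enum_rank _)) /=; last exact/onW_bij/enum_rank_bij.
  by apply: eq_bigr => p _; rewrite mxE enum_rankK.
move=> ij; rewrite mxE /= => /eqP W0.
have bd (p : calS t x) : boundary (val p).2.
  by have /in_calS[] := valP p.
apply: (boundary_down_time (bd (enum_val i)) (bd (enum_val j))).
  apply: trans_gt0_norm1; rewrite lt0r prob_ge0 andbT; exact/eqP.
by rewrite -!surjective_pairing (inj_eq val_inj) (inj_eq enum_val_inj).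
Qed.

Lemma det_Wminus_neq0 t x : \det (Wminus P Z t x) != 0.
Proof.
by rewrite det_Wminus gt_eqF // prodr_gt0 // => p _; exact: trans_down_gt0.
Qed.

(** Cramer's rule replaces the apex column of [Wminus] by column [p] of [Wplus];
    in the expansion over permutations, the factor at the apex is then the
    probability of reaching the reflected point [up], as in [coef]. *)
Lemma Nmx_apex t x (t0 : (0 < t)%N) (bx : boundary x) (p : calS t x) :
  Nmx P Z t x (enum_rank (apex t0 bx)) (enum_rank p) =
  coef P Z t0 bx (val p).1 (val p).2.
Proof.
rewrite /Nmx cramer_mulmx ?unitmxE ?unitfE ?det_Wminus_neq0 //.
rewrite det_Wminus /coef; congr (_ * _); set o := apex t0 bx.
pose A (q r : calS t x) := trans P Z (val q).1 (val q).2
  (if r == o then up (val p).2 (val p).1 else down (val r).2 (val r).1).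
rewrite (_ : \matrix_(k, l) _ = \matrix_(k, l) A (enum_val k) (enum_val l)).
  rewrite det_enum; apply: eq_bigr => sigma _.
  rewrite (bigD1 o) //= {1}/A eqxx mulrA; congr (_ * _).
  by apply: eq_bigr => q /negPf qo; rewrite /A qo.
apply/matrixP => k l; rewrite !mxE /A enum_rankK.
rewrite -{1}(enum_valK l) (inj_eq enum_rank_inj).
by case: eqP.
Qed.

End Walk.

Theorem proposition9 (R : realType) (disp : measure_display)
    (T : measurableType disp) (P : probability T R) (n : nat)
    (Z : 'rV[int]_n.+1 -> nat -> T -> 'rV[int]_n.+1)
    (markovZ : markov_family P Z) (nnZ : nearest_neighbour P Z)
    (t : nat) (x : 'rV[int]_n.+1) (t0 : (0 < t)%N) (bx : boundary x)
    (f : 'rV[int]_n.+1 -> R) (fB : vanishing_outside (@halfspace n) f) :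
  carr_nadtochiy P Z f (down x t) =
  \sum_(p : calS t x)
    coef P Z t0 bx (val p).1 (val p).2 * f (up (val p).2 (val p).1).
Proof.
rewrite carr_nadtochiyE /Nloc mxE.
rewrite (reindex (@enum_rank _)) /=; last exact/onW_bij/enum_rank_bij.
by apply: eq_bigr => p _; rewrite Nmx_apex // mxE enum_rankK.
Qed.
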